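(* Say a word $\sigma=\sigma_1\cdots\sigma_n$ over $\{1,\dots,k\}$ avoids $212$ if there is no index $i$ with $\sigma_{i+1}<\sigma_i=\sigma_{i+2}$, and let $F_{212}(x;k)=\sum_{n\ge0}f_{212}(n,k)x^n$, where $f_{212}(n,k)$ is the number of such words of length $n$. Then for all $k\ge0$, \[ F_{212}(x;k)=\frac{1}{1-x\sum_{j=0}^{k-1}\frac{1}{1+jx^2}}. \]
   Context: The empty word (length $0$) is counted once; for $k=0$ there are no words of positive length; empty sums are $0$. *)

(* Defs.v *)
From HB Require Import structures.
From mathcomp Require Import all_boot all_order all_algebra.
From mathcomp Require Import boolp.

Set Implicit Arguments.
Unset Strict Implicit.
Unset Printing Implicit Defensive.

Import GRing.Theory.
Local Open Scope ring_scope.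

(* [Fps f] is the formal power series \sum_(n >= 0) f n x^n. *)
Record fps (R : Type) := Fps { coefs : nat -> R }.

Lemma fpsP (R : Type) (f g : fps R) : coefs f =1 coefs g -> f = g.
Proof. by case: f g => f [g] /= /funext ->. Qed.

HB.instance Definition _ (R : Type) := gen_eqMixin (fps R).
HB.instance Definition _ (R : Type) := gen_choiceMixin (fps R).

Section FpsZmodule.
Variable V : zmodType.
Implicit Types f g : fps V.

Definition fps_zero : fps V := Fps (fun=> 0).
Definition fps_opp f : fps V := Fps (fun n => - coefs f n).
Definition fps_add f g : fps V := Fps (fun n => coefs f n + coefs g n).

Fact fps_addA : associative fps_add.
Proof. by move=> f g h; apply: fpsP => n /=; rewrite addrA. Qed.
Fact fps_addC : commutative fps_add.
Proof. by move=> f g; apply: fpsP => n /=; rewrite addrC. Qed.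
Fact fps_add0 : left_id fps_zero fps_add.
Proof. by move=> f; apply: fpsP => n /=; rewrite add0r. Qed.
Fact fps_addN : left_inverse fps_zero fps_opp fps_add.
Proof. by move=> f; apply: fpsP => n /=; rewrite addNr. Qed.

HB.instance Definition _ :=
  GRing.isZmodule.Build (fps V) fps_addA fps_addC fps_add0 fps_addN.

Lemma coefs0 n : coefs (0 : fps V) n = 0. Proof. by []. Qed.
Lemma coefsD f g n : coefs (f + g) n = coefs f n + coefs g n.
Proof. by []. Qed.
Lemma coefsN f n : coefs (- f) n = - coefs f n. Proof. by []. Qed.

End FpsZmodule.

Section FpsRing.
Variable R : comNzRingType.
Implicit Types f g h : fps R.

Definition fps_one : fps R := Fps (fun n => (n == 0%N)%:R).
Definition fps_mul f g : fps R :=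
  Fps (fun n => \sum_(j < n.+1) coefs f j * coefs g (n - j)%N).

Definition fps_trunc m f : {poly R} := \poly_(i < m) coefs f i.

Lemma coef_fps_trunc m f i : (i < m)%N -> (fps_trunc m f)`_i = coefs f i.
Proof. by move=> lt_im; rewrite coef_poly lt_im. Qed.

Lemma coef_fps_mul m f g i : (i < m)%N ->
  coefs (fps_mul f g) i = (fps_trunc m f * fps_trunc m g)`_i.
Proof.
move=> lt_im; rewrite coefM; apply: eq_bigr => j _.
rewrite !coef_fps_trunc //; first exact: leq_ltn_trans (leq_subr _ _) lt_im.
exact: leq_trans (ltn_ord j) lt_im.
Qed.

Fact fps_mulC : commutative fps_mul.
Proof.
by move=> f g; apply: fpsP => n; rewrite !(@coef_fps_mul n.+1) // mulrC.
Qed.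

Fact fps_mulA : associative fps_mul.
Proof.
move=> f g h; apply: fpsP => n; rewrite !(@coef_fps_mul n.+1) //.
transitivity ((fps_trunc n.+1 f * fps_trunc n.+1 g * fps_trunc n.+1 h)`_n).
  rewrite -mulrA !coefM; apply: eq_bigr => j _; congr (_ * _).
  have lt_jn : (n - j < n.+1)%N by rewrite ltnS leq_subr.
  by rewrite coef_fps_trunc // (@coef_fps_mul n.+1).
rewrite !coefM; apply: eq_bigr => j _; congr (_ * _).
by rewrite coef_fps_trunc // (@coef_fps_mul n.+1).
Qed.

Fact fps_mul1 : left_id fps_one fps_mul.
Proof.
move=> f; apply: fpsP => n /=.
rewrite big_ord_recl /= mul1r subn0 big1 ?addr0 // => j _.
by rewrite /= mul0r.
Qed.

Fact fps_mulD : left_distributive fps_mul +%R.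
Proof.
move=> f g h; apply: fpsP => n /=.
by rewrite -big_split; apply: eq_bigr => j _; rewrite mulrDl.
Qed.

Fact fps_one_neq0 : fps_one != 0.
Proof.
by apply/eqP => /(congr1 (fun f => coefs f 0)) /eqP; rewrite /= oner_eq0.
Qed.

HB.instance Definition _ := GRing.Zmodule_isComNzRing.Build (fps R)
  fps_mulA fps_mulC fps_mul1 fps_mulD fps_one_neq0.

Lemma coefs1 n : coefs (1 : fps R) n = (n == 0%N)%:R. Proof. by []. Qed.
Lemma coefsM f g n :
  coefs (f * g) n = \sum_(j < n.+1) coefs f j * coefs g (n - j)%N.
Proof. by []. Qed.

Definition fpsX : fps R := Fps (fun n => (n == 1%N)%:R).

End FpsRing.

Section FpsUnitRing.
Variable R : comUnitRingType.
Implicit Types f g : fps R.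

Definition fps_unit : {pred fps R} := fun f => coefs f 0 \is a GRing.unit.

(* The first n coefficients b_0, ..., b_(n-1) of the inverse of f, obtained by
   solving \sum_(j <= m) f_(m-j) b_j = (m == 0)%:R for b_m. *)
Fixpoint fps_inv_seq f n : seq R :=
  if n is m.+1 then
    let b := fps_inv_seq f m in
    rcons b ((coefs f 0)^-1 *
             ((m == 0%N)%:R - \sum_(j < m) coefs f (m - j)%N * b`_j))
  else [::].

(* As required by unitRingType, non-invertible series are left unchanged. *)
Definition fps_inv f : fps R :=
  if f \in fps_unit then Fps (fun n => (fps_inv_seq f n.+1)`_n) else f.

Lemma size_fps_inv_seq f n : size (fps_inv_seq f n) = n.
Proof. by elim: n => //= n IHn; rewrite size_rcons IHn. Qed.

Lemma nth_fps_inv_seq f m n : (n < m)%N ->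
  (fps_inv_seq f m)`_n = (fps_inv_seq f n.+1)`_n.
Proof.
elim: m => // m IHm; rewrite ltnS leq_eqVlt => /orP[/eqP -> // | lt_nm].
by rewrite -IHm //= nth_rcons size_fps_inv_seq lt_nm.
Qed.

Fact fps_mulV : {in fps_unit, left_inverse 1 fps_inv *%R}.
Proof.
move=> f Uf; rewrite mulrC; apply: fpsP => n.
rewrite mulrC coefsM coefs1 big_ord_recr /= subnn /fps_inv Uf.
rewrite [coefs _ n]/= nth_rcons size_fps_inv_seq ltnn eqxx mulrC mulVKr //.
suff -> : \sum_(i < n) coefs (Fps (fun m => (fps_inv_seq f m.+1)`_m)) i
           * coefs f (n - i)%N
         = \sum_(j < n) coefs f (n - j)%N * (fps_inv_seq f n)`_j.
  by rewrite addrC subrK.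
apply: eq_bigr => j _ /=.
by rewrite mulrC (@nth_fps_inv_seq f n).
Qed.

Fact fps_unitPl f g : g * f = 1 -> fps_unit f.
Proof.
move=> /(congr1 (fun h => coefs h 0)); rewrite coefsM big_ord1 => gf1.
by apply/unitrP; exists (coefs g 0); rewrite [coefs f 0 * _]mulrC gf1.
Qed.

Fact fps_inv_out : {in [predC fps_unit], fps_inv =1 id}.
Proof. by move=> f; rewrite inE /fps_inv => /negbTE ->. Qed.

HB.instance Definition _ := GRing.ComNzRing_hasMulInverse.Build (fps R)
  fps_mulV fps_unitPl fps_inv_out.

Lemma fps_unitE f : (f \is a GRing.unit) = (coefs f 0 \is a GRing.unit).
Proof. by []. Qed.

End FpsUnitRing.

(* The letters 1 < ... < k are represented by the elements 0 < ... < k - 1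
   of 'I_k. *)
Definition avoids212 (k n : nat) (s : n.-tuple 'I_k) : bool :=
  ~~ [exists i0 : 'I_n, exists i1 : 'I_n, exists i2 : 'I_n,
       [&& i1 == i0.+1 :> nat, i2 == i0.+2 :> nat,
           (tnth s i1 < tnth s i0)%N & tnth s i0 == tnth s i2]].

Definition f212 (n k : nat) : nat := #|[set s : n.-tuple 'I_k | avoids212 s]|.

Definition F212 (k : nat) : fps int := Fps (fun n => (f212 n k)%:Z).

(* Every denominator in the closed formula is invertible, so no junk value of
   the total inverse occurs there. *)
Lemma F212_inner_unit (j : nat) :
  1 + j%:R * fpsX int ^+ 2 \is a GRing.unit.
Proof.
by rewrite fps_unitE expr2 mulrA coefsD coefs1 coefsM big_ord1 mulr0 addr0.
Qed.

Lemma F212_outer_unit (h : fps int) : 1 - fpsX int * h \is a GRing.unit.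
Proof.
by rewrite fps_unitE coefsD coefsN coefs1 coefsM big_ord1 mul0r subr0.
Qed.

(* Main.v *)
(* Let C_a count, by length minus one, the avoiding words that start with the
   letter a of {0, ..., k - 1}. Prefixing an avoiding word w with a creates an
   occurrence of 212 exactly when w = b a w' with b < a, and such a w is
   avoiding as soon as a w' is. Hence C_a = F - a x^2 C_a, while
   F = 1 + x \sum_a C_a; eliminating the C_a gives the formula. *)

Require Import Defs.
From mathcomp Require Import all_boot all_order all_algebra.

Import GRing.Theory.
Local Open Scope ring_scope.

Lemma coefs_fpsXM (R : comNzRingType) (g : fps R) (n : nat) :
  coefs (fpsX R * g) n = if n is m.+1 then coefs g m else 0.
Proof.
rewrite coefsM big_ord_recl mul0r add0r.
case: n => [|n]; first by rewrite big_ord0.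
rewrite big_ord_recl /= mul1r subn1 big1 ?addr0 // => i _.
by rewrite mul0r.
Qed.

Lemma coefs_fpsX2M (R : comNzRingType) (g : fps R) (n : nat) :
  coefs (fpsX R ^+ 2 * g) n = if n is m.+2 then coefs g m else 0.
Proof.
rewrite expr2 -mulrA coefs_fpsXM.
by case: n => // n; rewrite coefs_fpsXM; case: n.
Qed.

Lemma coefs_natM (R : comNzRingType) (m : nat) (g : fps R) (n : nat) :
  coefs (m%:R * g) n = m%:R * coefs g n.
Proof.
by elim: m => [|m IHm]; rewrite ?mul0r // -[m.+1]addn1 !natrD !mulrDl !mul1r
  coefsD IHm.
Qed.

Lemma coefs_sum (V : zmodType) (I : finType) (G : I -> fps V) (n : nat) :
  coefs (\sum_i G i) n = \sum_i coefs (G i) n.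
Proof. by elim/big_rec2: _ => // i y1 y2 _ <-. Qed.

(** The summand [G] takes a bare sequence, so that letters can be peeled off a tuple without casts
    between lengths. *)
Lemma sum_tuple0 (T : finType) (G : seq T -> nat) :
  (\sum_(s : 0.-tuple T) G s = G [::])%N.
Proof.
rewrite (big_pred1 [tuple]) => [//|s].
by apply/esym/eqP; apply: tuple0.
Qed.

Lemma sum_tupleS (T : finType) (n : nat) (G : seq T -> nat) :
  (\sum_(s : n.+1.-tuple T) G s = \sum_a \sum_(s : n.-tuple T) G (a :: s))%N.
Proof.
rewrite pair_big /=.
rewrite (reindex (fun p : T * n.-tuple T => cons_tuple p.1 p.2)) //.
exists (fun s : n.+1.-tuple T => (thead s, behead_tuple s)) => [[a s] _|s _] /=.
  by congr (_, _); apply: val_inj.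
by rewrite [RHS]tuple_eta.
Qed.

Section Words.
Variable k : nat.
Implicit Types (a b c : 'I_k) (s : seq 'I_k).

(** Recursive form of avoidance: prefixing a letter adds a single test, on the first three
    letters. *)
Fixpoint avoids212_seq s : bool :=
  if s is a :: t then
    (if t is b :: c :: _ then ~~ ((b < a)%N && (a == c)) else true)
    && avoids212_seq t
  else true.

Lemma avoids212_seqP x0 s :
  reflect (forall i, (i.+2 < size s)%N ->
            ~~ ((nth x0 s i.+1 < nth x0 s i)%N && (nth x0 s i == nth x0 s i.+2)))
          (avoids212_seq s).
Proof.
elim: s => [|a s IHs] /=; first by apply: ReflectT.
apply: (iffP andP) => [[hd /IHs tl] [|i] lt_i | av].
- by case: s lt_i hd {tl IHs} => [|b [|c s]].
- exact: tl.
split; last by apply/IHs => i lt_i; apply: (av i.+1).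
by case: s av {IHs} => [|b [|c s]] // av; apply: (av 0%N).
Qed.

Lemma avoids212E n (s : n.-tuple 'I_k) : avoids212 s = avoids212_seq s.
Proof.
case: n s => [|n] s.
  rewrite (tuple0 s) /=; apply/existsP => -[[]] //.
(* The alphabet may be empty, so the default letter for [nth] has to come from the word, which is
   nonempty here. *)
have x0 := thead s.
apply/idP/(avoids212_seqP x0) => [av i|av].
  rewrite size_tuple => lt_i; apply: contra av => h.
  have lt_i1 := ltnW lt_i; have lt_i0 := ltnW lt_i1.
  apply/existsP; exists (Ordinal lt_i0).
  apply/existsP; exists (Ordinal lt_i1).
  apply/existsP; exists (Ordinal lt_i).
  by rewrite !eqxx !(tnth_nth x0).
apply/existsP => -[i0 /existsP[i1 /existsP[i2 /and4P[/eqP e1 /eqP e2 lt eq]]]].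
move: lt eq; rewrite !(tnth_nth x0) e1 e2 => lt eq.
have /av : (i0.+2 < size s)%N by rewrite size_tuple -e2.
by rewrite lt eq.
Qed.

Definition f212_from (n : nat) a : nat :=
  (\sum_(s : n.-tuple 'I_k) avoids212_seq (a :: s))%N.

Lemma f212E n : f212 n k = (\sum_(s : n.-tuple 'I_k) avoids212_seq s)%N.
Proof.
rewrite /f212 -sum1_card big_mkcond /=; apply: eq_bigr => s _.
by rewrite inE avoids212E; case: avoids212_seq.
Qed.

Lemma f212_0 : f212 0 k = 1%N.
Proof. by rewrite f212E (sum_tuple0 _ (fun s => avoids212_seq s)). Qed.

Lemma f212S n : f212 n.+1 k = (\sum_a f212_from n a)%N.
Proof. by rewrite f212E (sum_tupleS _ _ (fun s => avoids212_seq s)). Qed.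

(** A word of at most two letters cannot contain 212. This lemma and the next settle the two
    coefficients that the factor [x^2] does not reach. *)
Lemma f212_from0 a : f212_from 0 a = f212 0 k.
Proof. by rewrite f212_0 /f212_from (sum_tuple0 _ (fun s => avoids212_seq (a :: s))). Qed.

Lemma f212_from1 a : f212_from 1 a = f212 1 k.
Proof.
rewrite f212E /f212_from (sum_tupleS _ _ (fun s => avoids212_seq (a :: s))).
rewrite (sum_tupleS _ _ (fun s => avoids212_seq s)).
apply: eq_bigr => b _; rewrite (sum_tuple0 _ (fun s => avoids212_seq (a :: b :: s))).
by rewrite (sum_tuple0 _ (fun s => avoids212_seq (b :: s))).
Qed.

(** An occurrence of 212 starting at [b] would need a descent from [b] to [a]. *)
Lemma avoids212_seq_cons2 b a s :
  (b < a)%N -> avoids212_seq (b :: a :: s) = avoids212_seq (a :: s).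
Proof. by move=> lt_ba /=; case: s => // c s; rewrite ltnNge ltnW. Qed.

Lemma avoids212_seq_cons3 a b c s :
  (avoids212_seq (a :: b :: c :: s)
     + ((b < a)%N && (c == a)) * avoids212_seq (a :: s)
   = avoids212_seq (b :: c :: s))%N.
Proof.
rewrite [avoids212_seq (a :: b :: _)]/= -/(avoids212_seq (b :: c :: s)) eq_sym.
have [lt_ba|_] := boolP (b < a)%N; last by rewrite addn0.
have [->|_] := eqVneq c a; last by rewrite addn0.
by rewrite mul1n (avoids212_seq_cons2 _ _ _ lt_ba).
Qed.

(** Coefficient form of [C_a + a x^2 C_a = F]. The factor [a] is the number of letters [b < a] that
    can stand between two copies of [a]. *)
Lemma f212_fromSS n a : (f212_from n.+2 a + a * f212_from n a = f212 n.+2 k)%N.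
Proof.
have card_lt : (\sum_(b < k) (b < a) = a)%N.
  rewrite -[RHS]card_ord -sum1_card (big_ord_widen k (fun=> 1%N)) 1?ltnW //.
  by rewrite [RHS]big_mkcond; apply: eq_bigr => b _; case: (b < a)%N.
rewrite f212E /f212_from (sum_tupleS _ _ (fun s => avoids212_seq (a :: s))).
rewrite (sum_tupleS _ _ (fun s => avoids212_seq s)).
rewrite -[X in (_ + X * _)%N]card_lt big_distrl -big_split; apply: eq_bigr => b _ /=.
rewrite (sum_tupleS _ _ (fun s => avoids212_seq (a :: b :: s))).
rewrite (sum_tupleS _ _ (fun s => avoids212_seq (b :: s))).
(* Spreading the indicator over the third letter [c], with only [c = a] contributing, lets both
   sides be compared word by word. *)
have -> : ((b < a)%N = \sum_(c < k) ((b < a)%N && (c == a)) :> nat)%N.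
  by rewrite (bigD1 a) //= eqxx andbT big1 ?addn0 // => c /negbTE ->; rewrite andbF.
rewrite big_distrl -big_split; apply: eq_bigr => c _ /=.
rewrite big_distrr -big_split; apply: eq_bigr => s _.
exact: avoids212_seq_cons3.
Qed.

End Words.

Theorem theorem3p12 (k : nat) :
  F212 k =
  1 / (1 - fpsX int * \sum_(0 <= j < k) (1 / (1 + j%:R * fpsX int ^+ 2))).
Proof.
pose C (a : 'I_k) : fps int := Fps (fun n => (f212_from k n a)%:Z).
have CE a : C a = F212 k / (1 + a%:R * fpsX int ^+ 2).
  (* With the denominator cleared, coefficients 0 and 1 come from short words and all others from
     the recurrence. *)
  apply: (canRL (mulrK (F212_inner_unit a))); apply: fpsP => n.
  rewrite mulrDr mulr1 mulrCA [C a * _]mulrC coefsD coefs_natM coefs_fpsX2M.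
  case: n => [|[|n]] /=; rewrite ?mulr0 ?addr0 ?f212_from0 ?f212_from1 //.
  by rewrite -(f212_fromSS k _ a) PoszD PoszM natz.
have FE : F212 k = 1 + fpsX int * \sum_a C a.
  apply: fpsP => -[|n]; rewrite coefsD coefs1 coefs_fpsXM /=.
    by rewrite f212_0.
  rewrite add0r coefs_sum f212S -natz natr_sum.
  by apply: eq_bigr => a _; rewrite natz.
(* It remains to see that [F] times the denominator is 1; distributing [F] over the sum turns its
   terms back into the [C a]. *)
apply: (canRL (mulrK (F212_outer_unit _))).
rewrite mulrBr mulr1 mulrCA big_mkord mulr_sumr.
under eq_bigr => a _ do rewrite mul1r -CE.
by rewrite {1}FE addrK.
Qed.
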